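(* Let $\alpha\in(0,2)$, $\beta\in[-1,1]$, with $\beta=0$ if $\alpha=1$. Let $Y\sim S_\alpha(1,\beta)$. Let $X_1,X_2,\ldots$ be i.i.d. real random variables whose common distribution function $F_X$ is in the domain $\mathcal{D}_\alpha$ of normal attraction (form recalled in the context, with parameters $A>0$, $\beta$ and function $\epsilon$), and let $\sigma$ and $S_n$ be as in the context. Assume that there exist constants $K>0$ and $\gamma\ge 0$ such that $|\epsilon(x)|\le K/|x|^\gamma$ for all $x\ne0$. Then, as $n\to\infty$, $$d_{\mathrm{Kol}}(S_n,Y):=\sup_{x\in\mathbb{R}}\big|\mathbb{P}(S_n\le x)-\mathbb{P}(Y\le x)\big|=\begin{cases}O\Big(\big(d_{\mathcal{W}_3}(S_n,Y)\big)^{1/4}\Big),&\alpha\in[1,2),\\ O\Big(\big(d_{\mathcal{W}_2}(S_n,Y)\big)^{1/3}\Big),&\alpha\in(0,1).\end{cases}$$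
   Context: $Y\sim S_\alpha(1,\beta)$ means that for all $\lambda\in\mathbb{R}$, $\mathbb{E}[e^{i\lambda Y}]=\exp\{-|\lambda|^\alpha(1-i\beta\,\mathrm{sign}(\lambda)\tan\frac{\pi\alpha}{2})\}$ if $\alpha\ne1$, and $\mathbb{E}[e^{i\lambda Y}]=e^{-|\lambda|}$ if $\alpha=1$ (where $\beta=0$). A distribution function $F_X$ is in the domain $\mathcal{D}_\alpha$ of normal attraction of a stable law of exponent $\alpha$ if $$F_X(x)=1-\frac{A+\epsilon(x)}{x^\alpha}(1+\beta)\ \text{ for } x>0,\qquad F_X(x)=\frac{A+\epsilon(x)}{|x|^\alpha}(1-\beta)\ \text{ for } x<0,$$ where $A>0$, $\beta\in[-1,1]$, and $\epsilon:\mathbb{R}\to\mathbb{R}$ is a bounded measurable function vanishing at $\pm\infty$. Set $\sigma=\big(A\alpha\int_{\mathbb{R}}\frac{1-\cos y}{|y|^{1+\alpha}}\,dy\big)^{1/\alpha}$ and $$S_n=\frac{1}{\sigma}n^{-\frac1\alpha}\begin{cases}X_1+\cdots+X_n-n\mathbb{E}[X_1],&\alpha\in(1,2),\\ X_1+\cdots+X_n-n\mathbb{E}\big[X_1\mathbf{1}_{(0,\sigma n^{1/\alpha})}(|X_1|)\big],&\alpha=1,\\ X_1+\cdots+X_n,&\alpha\in(0,1).\end{cases}$$ The smooth Wasserstein distance of order $k\in\mathbb{N}$ between (the laws of) two random variables $U,V$ is $d_{\mathcal{W}_k}(U,V)=\sup_{h\in\mathcal{H}_k}|\mathbb{E}[h(U)]-\mathbb{E}[h(V)]|$,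 where $\mathcal{H}_k$ is the set of all bounded $k$-th order differentiable functions $h:\mathbb{R}\to\mathbb{R}$ with $\|h^{(j)}\|_\infty\le1$ for $j=0,1,\ldots,k$. *)

(* Defs.v *)
From HB Require Import structures.
From mathcomp Require Import all_boot all_order all_algebra.
From mathcomp Require Import complex.
From mathcomp Require Import all_classical all_reals all_analysis.
From mathcomp Require Import measurable_realfun.

Set Implicit Arguments.
Unset Strict Implicit.
Unset Printing Implicit Defensive.

Import Order.TTheory GRing.Theory Num.Theory.
Import numFieldNormedType.Exports.

Local Open Scope classical_set_scope.
Local Open Scope ring_scope.
Local Open Scope complex_scope.

Definition cexp (R : realType) (z : R[i]) : R[i] :=
  (expR (complex.Re z))%:C *
  (cos (complex.Im z) +i* sin (complex.Im z)).

Definition cexpectation d (T : measurableType d) (R : realType)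
    (P : probability T R) (Z : T -> R[i]) : R[i] :=
  fine 'E_P[fun w => complex.Re (Z w)] +i* fine 'E_P[fun w => complex.Im (Z w)].

Definition charfun d (T : measurableType d) (R : realType)
    (P : probability T R) (Y : {RV P >-> R}) (lambda : R) : R[i] :=
  cexpectation P (fun w => cexp ('i%C * (lambda * Y w)%:C)).

(* [Y ~ S_alpha(1, beta)]; for [alpha = 1] only [beta = 0] is meaningful. *)
Definition is_stable d (T : measurableType d) (R : realType)
    (P : probability T R) (alpha beta : R) (Y : {RV P >-> R}) : Prop :=
  forall lambda : R, charfun Y lambda =
    if alpha == 1 then cexp (- `|lambda| : R)%:C
    else cexp (- (`|lambda| `^ alpha)%:C *
      (1 - 'i%C * (beta * Num.sg lambda * tan (pi * alpha / 2))%:C)).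

Definition mutually_independent d (T : measurableType d) (R : realType)
    (P : probability T R) (X : nat -> {RV P >-> R}) : Prop :=
  forall (s : seq nat) (B : nat -> set R), uniq s ->
    (forall i, measurable (B i)) ->
    P (\bigcap_(i in [set` s]) (X i @^-1` B i)) =
    (\prod_(i <- s) P (X i @^-1` B i))%E.

Definition identically_distributed d (T : measurableType d) (R : realType)
    (P : probability T R) (X : nat -> {RV P >-> R}) : Prop :=
  forall (i j : nat) (B : set R), measurable B ->
    distribution P (X i) B = distribution P (X j) B.

Definition iid d (T : measurableType d) (R : realType)
    (P : probability T R) (X : nat -> {RV P >-> R}) : Prop :=
  mutually_independent X /\ identically_distributed X.

Definition normal_attraction (R : realType) (alpha A beta : R) (eps : R -> R)
    (F : R -> R) : Prop :=
  [/\ 0 < A, -1 <= beta <= 1,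
      [/\ measurable_fun setT eps,
          exists M : R, forall x, `|eps x| <= M,
          eps x @[x --> +oo] --> (0 : R) &
          eps x @[x --> -oo] --> (0 : R)],
      forall x : R, 0 < x -> F x = 1 - (A + eps x) / x `^ alpha * (1 + beta) &
      forall x : R, x < 0 -> F x = (A + eps x) / `|x| `^ alpha * (1 - beta)].

Definition stable_scale (R : realType) (alpha A : R) : R :=
  (A * alpha * \int[lebesgue_measure]_y ((1 - cos y) / `|y| `^ (1 + alpha)))
    `^ (alpha^-1).

(* The sequence is indexed from 0, so [X 0] plays the role of [X_1]. *)
Definition centering d (T : measurableType d) (R : realType)
    (P : probability T R) (X : nat -> {RV P >-> R}) (alpha A : R) (n : nat) :
    R :=
  if 1 < alpha then n%:R * fine 'E_P[X 0%N]
  else if alpha == 1 then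
    n%:R * fine 'E_P[fun w => X 0%N w *
      \1_(`]0, stable_scale alpha A * n%:R `^ (alpha^-1)[) `|X 0%N w| ]
  else 0.

Definition normalized_sum d (T : measurableType d) (R : realType)
    (P : probability T R) (X : nat -> {RV P >-> R}) (alpha A : R) (n : nat)
    (w : T) : R :=
  (stable_scale alpha A)^-1 * n%:R `^ (- alpha^-1) *
  ((\sum_(i < n) X i w) - centering X alpha A n).

Lemma measurable_normalized_sum d (T : measurableType d) (R : realType)
    (P : probability T R) (X : nat -> {RV P >-> R}) (alpha A : R) (n : nat) :
  measurable_fun setT (normalized_sum X alpha A n).
Proof.
apply: measurable_funM; first exact: measurable_cst.
apply: measurable_funB; last exact: measurable_cst.
by apply: measurable_sum => i; exact: measurable_funPT.
Qed.

HB.instance Definition _ d (T : measurableType d) (R : realType)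
    (P : probability T R) (X : nat -> {RV P >-> R}) (alpha A : R) (n : nat) :=
  isMeasurableFun.Build _ _ _ _ (normalized_sum X alpha A n)
    (measurable_normalized_sum X alpha A n).

(* Boundedness of [h] is the case [j = 0]; the [k]-th derivative need not be
   continuous. *)
Definition Hclass (R : realType) (k : nat) : set (R -> R) :=
  [set h | (forall j (x : R), (j < k)%N -> derivable (derive1n j h) x 1) /\
           (forall j (x : R), (j <= k)%N -> `|derive1n j h x| <= 1)].

(* [U] and [V] may live on different probability spaces: only their laws
   matter. *)
Definition smooth_wasserstein (R : realType) (k : nat)
    d (T : measurableType d) (P : probability T R) (U : {RV P >-> R})
    d' (T' : measurableType d') (Q : probability T' R) (V : {RV Q >-> R}) : R :=
  sup [set `|fine 'E_P[h \o U] - fine 'E_Q[h \o V]| | h in @Hclass R k].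

Definition kolmogorov (R : realType)
    d (T : measurableType d) (P : probability T R) (U : {RV P >-> R})
    d' (T' : measurableType d') (Q : probability T' R) (V : {RV Q >-> R}) : R :=
  sup [set `|fine (cdf U x) - fine (cdf V x)| | x in [set: R]].

(* Main.v *)
(** Only two facts about the laws matter: [Y] has a Lipschitz distribution
function, and indicators of half-lines can be smoothed at scale [delta] at the
cost of a factor [delta ^- k] in the derivatives up to order [k]. Sandwiching
the indicators gives [d_Kol <= L delta + C W_k / delta ^ k], and
[delta = (W_k / 2) ^ (1 / (k + 1))] balances the two terms.

The Lipschitz bound is obtained without Fourier inversion. The Fejér sum
[F(t) = |sum_(j < N) e ^ (i j t)| ^ 2 = sum_(j, l < N) cos ((j - l) t)] is
nonnegative and at least [(N cos 1) ^ 2] on [|t| <= 1 / N], while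
[|phi_Y(j - l)| = exp (- |j - l| ^ alpha)] is summable, so that
[E F(Y - x) <= C N] and [P (|Y - x| <= 1 / N) = O(1 / N)] uniformly in [x]. *)

Require Import Defs.
From mathcomp Require Import all_boot all_order all_algebra.
From mathcomp Require Import all_classical all_reals all_analysis.
From mathcomp Require Import complex measurable_realfun ring lra.

Set Implicit Arguments.
Unset Strict Implicit.
Unset Printing Implicit Defensive.

Import Order.TTheory GRing.Theory Num.Theory.
Import numFieldNormedType.Exports.

Local Open Scope classical_set_scope.
Local Open Scope ring_scope.

(** * Smooth cutoffs of half-lines *)

Definition clamp01 (R : realType) (t : R) : R := Num.max 0 (Num.min t 1).

Lemma clamp01_itv (R : realType) (t : R) : 0 <= clamp01 t <= 1.
Proof. by rewrite /clamp01 le_max lexx ge_max ler01 ge_min lexx orbT. Qed.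

Lemma clamp01_le0 (R : realType) (t : R) : t <= 0 -> clamp01 t = 0.
Proof.
move=> t0; apply/max_idPl; rewrite ge_min t0 //.
Qed.

Lemma clamp01_ge1 (R : realType) (t : R) : 1 <= t -> clamp01 t = 1.
Proof. by move=> t1; rewrite /clamp01 (min_idPr t1) (max_idPr ler01). Qed.

Lemma clamp01_id (R : realType) (t : R) : 0 <= t <= 1 -> clamp01 t = t.
Proof.
by move=> /andP[t0 t1]; rewrite /clamp01 (min_idPl t1) (max_idPr t0).
Qed.

Lemma clamp01_lipschitz (R : realType) (s t : R) :
  `|clamp01 s - clamp01 t| <= `|s - t|.
Proof.
have : `|Num.min s 1 - Num.min t 1| <= `|s - t|.
  case: (leP s 1) => ?; case: (leP t 1) => ? //.
  - by rewrite ler_norml; apply/andP; split;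
      case: (ler0P (s - t)) => ?; lra.
  - by rewrite ler_norml; apply/andP; split;
      case: (ler0P (s - t)) => ?; lra.
  - by rewrite subrr normr0.
apply: le_trans; rewrite /clamp01; set u := Num.min s 1; set v := Num.min t 1.
case: (leP 0 u) => ?; case: (leP 0 v) => ? //.
- by rewrite ler_norml; apply/andP; split; case: (ler0P (u - v)) => ?; lra.
- by rewrite ler_norml; apply/andP; split; case: (ler0P (u - v)) => ?; lra.
- by rewrite subrr normr0.
Qed.

Lemma continuous_clamp01 (R : realType) : continuous (@clamp01 R).
Proof.
move=> t; apply/cvgrPdist_le => e e0.
near=> s; apply: le_trans (clamp01_lipschitz t s) _.
by near: s; move/cvgrPdist_le: (@cvg_id _ (nbhs t)); apply.
Unshelve. all: by end_near. Qed.

(** The corners of the clamp at 0 and 1 do no harm: [f'] vanishes there, and the clamp, being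
    1-Lipschitz, cannot enlarge the increments of [f]. *)
Lemma is_derive_comp_clamp01 (R : realType) (f f' : R -> R) (t : R) :
  (forall s : R, is_derive s 1 f (f' s)) -> f' 0 = 0 -> f' 1 = 0 ->
  is_derive t 1 (f \o @clamp01 R) (f' (clamp01 t)).
Proof.
move=> df f'0 f'1.
have [t01|t01] := boolP (0 < t < 1).
  have {t01}[t0 t1] := andP t01.
  rewrite clamp01_id; last by rewrite !ltW.
  apply: near_eq_is_derive (df t).
  near=> s; rewrite /= clamp01_id//.
  suff : s \in `]0, 1[ by rewrite in_itv/= => /andP[s0 s1]; rewrite !ltW.
  by near: s; apply: near_in_itvoo; rewrite in_itv/= t0.
have f't : f' (clamp01 t) = 0.
  move: t01; rewrite negb_and -!leNgt => /orP[t0|t1].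
    by rewrite clamp01_le0.
  by rewrite clamp01_ge1.
rewrite f't.
(* Carathéodory's form of the derivative: [g] is the slope of [f] at [clamp01 t], continuous there
   with value 0. The slope of the composite is [g] times a ratio of modulus at most 1, which is
   [0 / 0 = 0] at [z = t]. *)
have /is_derive1_caratheodory[g [gE gc g0]] := df (clamp01 t).
apply/is_derive1_caratheodory.
exists (fun z => g (clamp01 z) *
   ((clamp01 z - clamp01 t) / (z - t))); split.
- move=> z /=; rewrite gE; have [->|zt] := eqVneq z t.
    by rewrite !subrr !mulr0.
  by rewrite -mulrA divfK// subr_eq0.
- have gc0 : g (clamp01 z) @[z --> t] --> (0 : R).
    rewrite -f't -g0; apply: continuous_comp => //.
    exact: continuous_clamp01.
  rewrite /prop_for/= /continuous_at subrr mul0r mulr0.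
  apply: norm_cvg0; apply: (@squeeze_cvgr _ _ _ _ (cst 0) (fun z => `|g (clamp01 z)|)).
  + near=> z; rewrite normr_ge0 /= normrM ler_piMr//.
    have [->|zt] := eqVneq z t; first by rewrite !subrr mul0r normr0.
    rewrite normrM normfV ler_pdivrMr ?normr_gt0 ?subr_eq0//.
    by rewrite mul1r clamp01_lipschitz.
  + exact: cvg_cst.
  + by rewrite -[X in _ --> X](@normr0 R R); exact: cvg_norm gc0.
- by rewrite subrr mul0r mulr0.
Unshelve. all: by end_near. Qed.

(* The Bernstein form makes [0 <= p <= 1] on [[0, 1]] visible: with
   [s := 1 - t], [p t + p s = (t + s) ^+ 7 = 1]. The entries [j > 0] are its
   successive derivatives (only [j <= 3] is meaningful). *)
Definition smoothstep (R : realType) (j : nat) (t : R) : R :=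
  match j with
  | 0 => t ^+ 4 * (35 * (1 - t) ^+ 3 + 21 * t * (1 - t) ^+ 2
                   + 7 * t ^+ 2 * (1 - t) + t ^+ 3)
  | 1 => 140 * (t ^+ 3 * (1 - t) ^+ 3)
  | 2 => 420 * (t ^+ 2 * (1 - t) ^+ 2 * (1 - 2 * t))
  | _ => 840 * (t * (1 - t) * ((1 - 2 * t) ^+ 2 - t * (1 - t)))
  end.

Lemma is_derive_smoothstep (R : realType) (j : nat) (t : R) : (j < 3)%N ->
  is_derive t 1 (@smoothstep R j) (smoothstep j.+1 t).
Proof.
case: j => [|[|[|//]]] _; rewrite /smoothstep.
- by apply: is_derive_eq; rewrite /GRing.scale/=; ring.
- by apply: is_derive_eq; rewrite /GRing.scale/=; ring.
- by apply: is_derive_eq; rewrite /GRing.scale/=; ring.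
Qed.

Lemma smoothstep_itv (R : realType) (t : R) :
  0 <= t <= 1 -> 0 <= smoothstep 0 t <= 1.
Proof.
have ge0 s : 0 <= s <= 1 -> 0 <= smoothstep 0 s.
  by move=> /andP[s0 s1]; rewrite mulr_ge0 ?exprn_ge0// !addr_ge0//
    ?mulr_ge0 ?exprn_ge0 ?subr_ge0// ?mulr_ge0.
move=> t01; rewrite ge0//.
have -> : smoothstep 0 t = 1 - smoothstep 0 (1 - t).
  by rewrite /smoothstep; ring.
by rewrite gerBl ge0//; move: t01 => /andP[? ?]; lra.
Qed.

(** The numerical factors are at most 840, and the remaining polynomial factors have modulus at most
    1 on the unit interval. *)
Lemma smoothstep_bound (R : realType) (j : nat) (t : R) :
  0 <= t <= 1 -> `|smoothstep j t| <= 840.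
Proof.
move=> t01; have /andP[t0 t1] := t01.
have s0 : 0 <= 1 - t by rewrite subr_ge0.
have s1 : 1 - t <= 1 by rewrite gerBl.
have u1 : `|1 - 2 * t| <= 1 by rewrite ler_norml; lra.
case: j => [|[|[|j]]].
- have /andP[p0 p1] := smoothstep_itv t01.
  by rewrite ger0_norm// (le_trans p1)// ler1n.
- rewrite /smoothstep ger0_norm ?mulr_ge0 ?exprn_ge0//.
  have : t ^+ 3 * (1 - t) ^+ 3 <= 1 by rewrite mulr_ile1 ?exprn_ile1 ?exprn_ge0.
  by lra.
- rewrite /smoothstep normrM normr_nat.
  have a0 : 0 <= t ^+ 2 * (1 - t) ^+ 2 by rewrite mulr_ge0 ?exprn_ge0.
  have a1 : t ^+ 2 * (1 - t) ^+ 2 <= 1.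
    by rewrite mulr_ile1 ?exprn_ile1 ?exprn_ge0.
  have : `|t ^+ 2 * (1 - t) ^+ 2 * (1 - 2 * t)| <= 1.
    by rewrite normrM (ger0_norm a0) mulr_ile1.
  by lra.
- rewrite /smoothstep normrM normr_nat.
  have a0 : 0 <= t * (1 - t) by rewrite mulr_ge0.
  have a1 : t * (1 - t) <= 1 by rewrite mulr_ile1.
  have : `|t * (1 - t) * ((1 - 2 * t) ^+ 2 - t * (1 - t))| <= 1.
    rewrite normrM (ger0_norm a0) mulr_ile1// ler_norml.
    by apply/andP; split; nra.
  by lra.
Qed.

(** A smoothed indicator of []-oo, a]], falling from 1 to 0 between [a - delta] and [a]. *)
Definition smooth_cut (R : realType) (a delta t : R) : R :=
  smoothstep 0 (clamp01 ((a - t) / delta)).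

Lemma smooth_cut_ge (R : realType) (a delta t : R) : 0 < delta ->
  (t <= a - delta)%R%:R <= smooth_cut a delta t.
Proof.
move=> d0; case: (leP t (a - delta)) => ta; last first.
  have /andP[p0 p1] := smoothstep_itv (clamp01_itv ((a - t) / delta)).
  exact: p0.
rewrite /smooth_cut clamp01_ge1; last by rewrite ler_pdivlMr//; lra.
have -> : smoothstep 0 1 = 1 :> R by rewrite /smoothstep; ring.
by [].
Qed.

Lemma smooth_cut_le (R : realType) (a delta t : R) : 0 < delta ->
  smooth_cut a delta t <= (t <= a)%R%:R.
Proof.
move=> d0; case: (leP t a) => ta.
  have /andP[p0 p1] := smoothstep_itv (clamp01_itv ((a - t) / delta)).
  exact: p1.
rewrite /smooth_cut clamp01_le0; last by rewrite pmulr_lle0 ?invr_gt0//; lra.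
by rewrite /smoothstep expr0n mul0r.
Qed.

(** The entries 1, 2 and 3 of [smoothstep] all vanish at 0 and 1, so clamping preserves three orders
    of differentiability. *)
Lemma is_derive_smooth_cut (R : realType) (j : nat) (a delta t : R) :
  (j < 3)%N ->
  is_derive t 1 (fun s => smoothstep j (clamp01 ((a - s) / delta)))
    (- delta^-1 * smoothstep j.+1 (clamp01 ((a - t) / delta))).
Proof.
move=> j3; rewrite mulrC.
apply: (@is_derive1_comp R (@smoothstep R j \o @clamp01 R)
  (fun s => (a - s) / delta)).
  apply: is_derive_comp_clamp01.
  - by move=> s; exact: is_derive_smoothstep.
  - by case: j j3 => [|[|[|//]]] _; rewrite /smoothstep; ring.
  - by case: j j3 => [|[|[|//]]] _; rewrite /smoothstep; ring.
by apply: is_derive_eq; rewrite /GRing.scale/=; ring.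
Qed.

(** The [j]-th derivative of the cut is at most [840 / delta ^+ j], and [delta <= 1] makes order [k]
    the worst one. *)
Lemma Hclass_smooth_cut (R : realType) (k : nat) (a delta : R) : (k <= 3)%N ->
  0 < delta <= 1 ->
  @Hclass R k (fun t => delta ^+ k / 840 * smooth_cut a delta t).
Proof.
move=> k3 /andP[d0 d1]; set h := (X in Hclass _ X).
have hder j (t : R) : (j < 3)%N -> is_derive t 1
    (fun s => delta ^+ k / 840 * ((- delta^-1) ^+ j *
       smoothstep j (clamp01 ((a - s) / delta))))
    (delta ^+ k / 840 * ((- delta^-1) ^+ j.+1 *
       smoothstep j.+1 (clamp01 ((a - t) / delta)))).
  move=> j3; have ? := is_derive_smooth_cut a delta t j3.
  apply: is_derive_eq.
  rewrite -[LHS]/(delta ^+ k / 840 * ((- delta^-1) ^+ j *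
    (- delta^-1 * smoothstep j.+1 (clamp01 ((a - t) / delta))))).
  by rewrite exprSr -!mulrA.
(* Each differentiation moves to the next entry of [smoothstep] and contributes a factor
   [- delta^-1]. *)
have hE j : (j <= 3)%N -> derive1n j h = fun t =>
    delta ^+ k / 840 * ((- delta^-1) ^+ j *
       smoothstep j (clamp01 ((a - t) / delta))).
  elim: j => [_|j IH j3].
    by apply/funext => t; rewrite /derive1n/= expr0 mul1r.
  have -> : derive1n j.+1 h = derive1 (derive1n j h) by [].
  rewrite (IH (ltnW j3)).
  by apply/funext => t; rewrite derive1E (@derive_val _ _ _ _ _ _ _ (hder j t j3)).
split=> j t jk.
  have j3 := leq_trans jk k3.
  by rewrite (hE _ (ltnW j3)); have [] := hder j t j3.
rewrite (hE _ (leq_trans jk k3)) !normrM !normrX normrN !normfV normr_nat (gtr0_norm d0).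
have p840 := smoothstep_bound j (clamp01_itv ((a - t) / delta)).
have -> : delta ^+ k / 840 *
    (delta^-1 ^+ j * `|smoothstep j (clamp01 ((a - t) / delta))|) =
    delta ^+ (k - j) * (`|smoothstep j (clamp01 ((a - t) / delta))| / 840).
  by rewrite -{1}(subnK jk) exprD exprVn; field; rewrite expf_neq0 ?gt_eqF.
apply: mulr_ile1.
- exact/exprn_ge0/ltW.
- exact: divr_ge0 (normr_ge0 _) (ler0n _ _).
- exact: exprn_ile1 (ltW d0) d1.
- by rewrite ler_pdivrMr ?ltr0n// mul1r.
Qed.

(** * Integrals of bounded functions *)

Lemma bounded_integrable d (T : measurableType d) (R : realType)
    (P : probability T R) (f : T -> R) (M : R) :
  measurable_fun setT f -> (forall w, `|f w| <= M) ->
  P.-integrable setT (EFin \o f).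
Proof.
move=> mf fM; apply: measurable_bounded_integrable => //.
  exact: fin_num_fun_lty.
exists M; split; first exact: num_real.
by move=> x Mx w _; exact: le_trans (fM w) (ltW Mx).
Qed.

Lemma fine_expectation d (T : measurableType d) (R : realType)
    (P : probability T R) (f : T -> R) :
  fine 'E_P[f] = \int[P]_w f w.
Proof. by rewrite unlock. Qed.

Lemma measurable_indicator_le d (T : measurableType d) (R : realType)
    (f : T -> R) (x : R) : measurable_fun setT f ->
  measurable_fun setT (fun w => (f w <= x)%R%:R : R).
Proof.
move=> mf.
have -> : (fun w => (f w <= x)%R%:R) = (\1_(`]-oo, x]%classic) : R -> R) \o f.
  by apply/funext => w; rewrite /= indicE mem_setE in_itv.
by apply: measurableT_comp => //; exact: measurable_indic.
Qed.

Lemma fine_cdf d (T : measurableType d) (R : realType)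
    (P : probability T R) (U : {RV P >-> R}) (x : R) :
  fine (cdf U x) = \int[P]_w (U w <= x)%R%:R.
Proof.
rewrite /cdf /distribution /pushforward /Rintegral.
rewrite -[X in P X]setIT -integral_indic//; last first.
  by rewrite -[X in measurable X]setTI; exact: measurable_funPT.
by congr fine; apply: eq_integral => w _;
  rewrite indicE; congr ((nat_of_bool _)%:R%:E); apply/idP/idP; rewrite inE/= in_itv.
Qed.

Lemma Rintegral_sum d (T : measurableType d) (R : realType)
    (P : probability T R) (I : Type) (r : seq I) (f : I -> T -> R) (M : I -> R) :
  (forall i, measurable_fun setT (f i)) -> (forall i w, `|f i w| <= M i) ->
  \int[P]_w (\sum_(i <- r) f i w) = \sum_(i <- r) \int[P]_w f i w.
Proof.
move=> mf fM; elim: r => [|i r IH].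
  under eq_Rintegral do rewrite big_nil.
  by rewrite big_nil Rintegral_cst// mul0r.
under eq_Rintegral do rewrite big_cons.
rewrite big_cons RintegralD ?IH//; first exact: bounded_integrable (fM i).
apply: (@bounded_integrable _ _ _ _ _ (\sum_(i <- r) M i)).
  exact: measurable_sum.
by move=> w; rewrite (le_trans (ler_norm_sum _ _ _))// ler_sum.
Qed.

Lemma Rintegral_prob_cst d (T : measurableType d) (R : realType)
    (P : probability T R) (c : R) : \int[P]_w c = c.
Proof.
transitivity (c * fine (P setT)); first exact: Rintegral_cst.
by rewrite probability_setT mulr1.
Qed.

Lemma Rintegral_prob_bound d (T : measurableType d) (R : realType)
    (P : probability T R) (f : T -> R) (M : R) :
  measurable_fun setT f -> (forall w, `|f w| <= M) ->
  `|\int[P]_w f w| <= M.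
Proof.
move=> mf fM; have If := @bounded_integrable _ _ _ P f M mf fM.
apply: le_trans (le_normr_Rintegral _ If) _ => //.
rewrite -[leRHS](Rintegral_prob_cst P); apply: le_Rintegral => //.
- apply: (@bounded_integrable _ _ _ P _ M); first exact: measurableT_comp.
  by move=> w; rewrite normr_id.
- by apply: (@bounded_integrable _ _ _ P _ `|M|).
Qed.

(** * Lipschitz bound for the stable distribution function *)

Lemma cos_charfun d (T : measurableType d) (R : realType)
    (P : probability T R) (U : {RV P >-> R}) (l a : R) :
  \int[P]_w cos (l * (U w - a)) =
  cos (l * a) * complex.Re (charfun U l) + sin (l * a) * complex.Im (charfun U l).
Proof.
rewrite /charfun /cexpectation /= !fine_expectation.
have cU : measurable_fun setT (fun w => cos (l * U w)).
  apply: (@measurableT_comp _ _ _ _ _ _ (@cos R) _ (fun w => l * U w)).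
    by apply: continuous_measurable_fun; exact: continuous_cos.
  by apply: measurable_funM => //; exact: measurable_funPT.
have sU : measurable_fun setT (fun w => sin (l * U w)).
  apply: (@measurableT_comp _ _ _ _ _ _ (@sin R) _ (fun w => l * U w)).
    by apply: continuous_measurable_fun; exact: continuous_sin.
  by apply: measurable_funM => //; exact: measurable_funPT.
have Ic := @bounded_integrable _ _ _ P _ 1 cU (fun w => cos_max _).
have Is := @bounded_integrable _ _ _ P _ 1 sU (fun w => sin_max _).
transitivity (\int[P]_w (cos (l * a) * cos (l * U w) + sin (l * a) * sin (l * U w))).
  by apply: eq_Rintegral => w _; rewrite mulrBr cosB; ring.
rewrite RintegralD//.
- rewrite !RintegralZl//; congr (_ * _ + _ * _); apply: eq_Rintegral => w _.
  + by rewrite /cexp /= !(mul0r, mul1r, subr0, add0r, addr0, mulr0, oppr0, expR0).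
  + by rewrite /cexp /= !(mul0r, mul1r, subr0, add0r, addr0, mulr0, oppr0, expR0).
- apply: (@bounded_integrable _ _ _ P _ `|cos (l * a)|).
    exact: measurable_funM.
  by move=> w; rewrite normrM ler_piMr// cos_max.
- apply: (@bounded_integrable _ _ _ P _ `|sin (l * a)|).
    exact: measurable_funM.
  by move=> w; rewrite normrM ler_piMr// sin_max.
Qed.

(** The integral is the real part of [exp (- i l a) * charfun Y l], hence at most the modulus of
    [charfun Y l]. The skewness term only rotates the phase, so this modulus does not depend on
    [beta]. *)
Lemma stable_cos_le d (T : measurableType d) (R : realType)
    (P : probability T R) (alpha beta : R) (Y : {RV P >-> R}) (l a : R) :
  is_stable alpha beta Y ->
  \int[P]_w cos (l * (Y w - a)) <= expR (- `|l| `^ alpha).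
Proof.
move=> hY; rewrite cos_charfun hY.
have polar (z : R[i]) : cos (l * a) * complex.Re (cexp z) +
    sin (l * a) * complex.Im (cexp z) <= expR (complex.Re z).
  case: z => r t; rewrite /cexp /= !mul0r subr0 addr0.
  have -> : cos (l * a) * (expR r * cos t) + sin (l * a) * (expR r * sin t) =
    expR r * cos (l * a - t) by rewrite cosB; ring.
  by rewrite ger_pMr ?expR_gt0// cos_le1.
case: eqP => [->|_]; apply: le_trans (polar _) _; rewrite ler_expR /=.
  by rewrite powRr1.
by rewrite !(mul0r, mul1r, subr0, add0r, addr0, mulr0, mulr1, oppr0).
Qed.

(** The telescoping bound is what makes the induction close: [1 / (n + 1) ^ 2 <= 2 / (n + 1) - 2 /
    (n + 2)]. *)
Lemma sum_inv_sqr_le (R : realType) (N : nat) :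
  \sum_(m < N) (m.+1%:R ^+ 2)^-1 <= 2 * (1 - N.+1%:R^-1) :> R.
Proof.
elim: N => [|N IH]; first by rewrite big_ord0 invr1 subrr mulr0.
rewrite big_ord_recr/=; apply: le_trans (lerD IH (lexx _)) _.
have n0 : 0 <= N%:R :> R by [].
have -> : N.+2%:R = N%:R + 2 :> R by rewrite -addn2 natrD.
have -> : N.+1%:R = N%:R + 1 :> R by rewrite -addn1 natrD.
rewrite -subr_ge0; set n := N%:R in n0 *.
have -> : 2 * (1 - (n + 2)^-1) - (2 * (1 - (n + 1)^-1) + ((n + 1) ^+ 2)^-1) =
    n / ((n + 1) ^+ 2 * (n + 2)).
  by field; rewrite !gt_eqF//; lra.
by rewrite divr_ge0 ?mulr_ge0 ?exprn_ge0//; lra.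
Qed.

(** One term of the exponential series already dominates [m ^ 2], so the sum is compared with that
    of the inverse squares. *)
Lemma sum_expR_powR_bounded (R : realType) (alpha : R) : 0 < alpha ->
  exists2 C : R, 0 < C & forall N, \sum_(m < N) expR (- m%:R `^ alpha) <= C.
Proof.
move=> a0; pose p := Num.trunc (2 / alpha).
have p2 : 2 <= alpha * p.+1%:R.
  rewrite mulrC -ler_pdivrMr//.
  have a1 : 0 <= 2 / alpha by rewrite divr_ge0// ltW.
  by have /andP[_ /ltW] := truncn_itv a1.
have pf : 0 < (p.+1)`!%:R :> R by rewrite ltr0n fact_gt0.
exists (8 * (p.+1)`!%:R) => [|N]; first by rewrite mulr_gt0.
(* The factor 4 absorbs [(m + 1) ^ 2 <= 2 * (m ^ 2 + 1)]; the bound 2 on the sum of inverse squares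
   then gives 8. *)
have term m : expR (- m%:R `^ alpha) <= 4 * (p.+1)`!%:R * (m.+1%:R ^+ 2)^-1.
  rewrite expRN -invf_div; rewrite lef_pV2 ?posrE ?expR_gt0 ?divr_gt0 ?mulr_gt0//.
  rewrite ler_pdivrMr ?mulr_gt0//.
  have := expR_ge1Dxn p (powR_ge0 m%:R alpha).
  rewrite -(ler_pM2r pf) mulrDl mul1r divfK ?gt_eqF// -powR_mulrn ?powR_ge0//.
  rewrite -powRrM => h.
  have f1 : 1 <= (p.+1)`!%:R :> R by rewrite ler1n fact_gt0.
  suff : m%:R ^+ 2 <= m%:R `^ (alpha * p.+1%:R) :> R.
    have m0 : 0 <= m%:R :> R by [].
    rewrite -[m.+1]addn1 natrD => hm.
    have : 0 <= (m%:R - 1) ^+ 2 :> R by exact: sqr_ge0.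
    nra.
  case: m {h} => [|m]; first by rewrite expr0n powR_ge0.
  by rewrite -powR_mulrn// ler_powR// ler1n.
apply: le_trans; first by apply: ler_sum => m _; exact: term.
rewrite -mulr_sumr.
apply: (@le_trans _ _ (4 * (p.+1)`!%:R * 2)); last first.
  have -> : 8 = 4 * 2 :> R by ring.
  by rewrite mulrAC.
rewrite ler_pM2l ?mulr_gt0//; apply: le_trans (sum_inv_sqr_le R N) _.
by rewrite ler_piMr// gerBl.
Qed.

(** With truncated subtraction, [(i - j) + (j - i)] is the distance between [i] and [j]. Enlarging
    the square from [N] to [N.+1] adds one row and one column, each at most a partial sum of [f]. *)
Lemma sum_distance_le (R : realType) (f : nat -> R) (C : R) (N : nat) :
  (forall m, 0 <= f m) -> (forall M, \sum_(m < M) f m <= C) ->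
  \sum_(i < N) \sum_(j < N) f ((i - j) + (j - i))%N <= N%:R * (2 * C).
Proof.
move=> f0 fC; elim: N => [|N IH]; first by rewrite big_ord0 mul0r.
rewrite big_ord_recr/=.
under eq_bigr do rewrite big_ord_recr/=.
rewrite big_split/= -[N.+1]addn1 natrD mulrDl mul1r -addrA addn1.
apply: lerD IH _.
(* The new row contains the diagonal entry, so its distances run from [N] down to 0; the new column
   has the same ones except 0. *)
have rowE : \sum_(j < N.+1) f ((N - j) + (j - N))%N = \sum_(j < N.+1) f j.
  rewrite [RHS](reindex_inj rev_ord_inj)/=; apply: eq_bigr => j _.
  by rewrite subSS (eqP (_ : (j - N)%N == 0%N)) ?addn0// subn_eq0 -ltnS.
have colE : \sum_(i < N) f ((i - N) + (N - i))%N <=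
    \sum_(j < N.+1) f ((N - j) + (j - N))%N.
  rewrite [leRHS]big_ord_recr/=; apply: ler_wpDr => //.
  by apply: ler_sum => i _; rewrite addnC.
rewrite mulr_natl mulr2n; apply: lerD; last by rewrite rowE.
by apply: le_trans colE _; rewrite rowE.
Qed.

Lemma fejer_square (R : realType) (N : nat) (t : R) :
  \sum_(i < N) \sum_(j < N) cos ((i%:R - j%:R) * t) =
  (\sum_(i < N) cos (i%:R * t)) ^+ 2 + (\sum_(i < N) sin (i%:R * t)) ^+ 2.
Proof.
rewrite !expr2 !big_distrlr/= -big_split/=; apply: eq_bigr => i _.
by rewrite -big_split/=; apply: eq_bigr => j _; rewrite mulrBl cosB.
Qed.

Lemma cos_ge_cos1 (R : realType) (t : R) : `|t| <= 1 -> cos 1 <= cos t.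
Proof.
move=> t1; have pi1 : 1 <= pi :> R by have := @pi_ge2 R; lra.
have -> : cos t = cos `|t| by case: (ger0P t) => // _; rewrite cosN.
have c01 (u : R) : 0 <= u <= 1 -> u \in `[0, pi].
  by move=> /andP[u0 u1]; rewrite in_itv/= u0 (le_trans u1).
rewrite leNgt ltr_cos ?c01 ?normr_ge0 ?t1 ?lexx ?ler01//.
by rewrite -leNgt.
Qed.

(** All phases [i * t] with [i < N] stay in [[-1, 1]], where the cosine is at least [cos 1 > 0]; the
    squared sine sum is dropped. *)
Lemma fejer_ge (R : realType) (N : nat) (t : R) : (0 < N)%N ->
  `|t| <= N%:R^-1 ->
  (N%:R * cos 1) ^+ 2 <= \sum_(i < N) \sum_(j < N) cos ((i%:R - j%:R) * t).
Proof.
move=> N0 tN; rewrite fejer_square; apply: ler_wpDr; first exact: sqr_ge0.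
have Nc0 : 0 <= N%:R * cos 1 :> R by rewrite mulr_ge0// ltW// cos1_gt0.
suff Nc : N%:R * cos 1 <= \sum_(i < N) cos (i%:R * t).
  by rewrite lerXn2r// nnegrE// (le_trans Nc0).
have -> : N%:R * cos 1 = \sum_(i < N) cos 1 :> R.
  by rewrite sumr_const card_ord mulr_natl.
apply: ler_sum => i _; apply: cos_ge_cos1.
rewrite normrM normr_nat; apply: (@le_trans _ _ (N%:R * N%:R^-1)).
  by rewrite ler_pM// ler_nat ltnW.
by rewrite divff// pnatr_eq0 -lt0n.
Qed.

Lemma fejer_ge0 (R : realType) (N : nat) (t : R) :
  0 <= \sum_(i < N) \sum_(j < N) cos ((i%:R - j%:R) * t).
Proof. by rewrite fejer_square addr_ge0// sqr_ge0. Qed.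

Lemma stable_cdf_increment d (T : measurableType d) (R : realType)
    (P : probability T R) (alpha beta : R) (Y : {RV P >-> R}) :
  0 < alpha -> is_stable alpha beta Y ->
  exists2 L : R, 0 < L & forall x delta, 0 < delta <= 1 ->
    fine (cdf Y (x + delta)) - fine (cdf Y x) <= L * delta.
Proof.
move=> a0 hY; have [C C0 sumC] := sum_expR_powR_bounded a0.
have c1 : 0 < cos 1 :> R := @cos1_gt0 R.
exists (4 * C / cos 1 ^+ 2) => [|x delta /andP[d0 d1]].
  by rewrite divr_gt0 ?mulr_gt0 ?exprn_gt0.
(* [N] is the integer part of [1 / delta], so that [delta <= 1 / N <= 2 * delta]; the last factor 2
   turns [2 * C] into the [4 * C] of the witness. *)
pose N := Num.trunc delta^-1.
have dV0 : 0 <= delta^-1 by rewrite invr_ge0 ltW.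
have N0 : (0 < N)%N by rewrite truncn_gt0 invf_ge1.
have n0 : 0 < N%:R :> R by rewrite ltr0n.
have /andP[Nd dN] := truncn_itv dV0.
have dNV : delta <= N%:R^-1.
  rewrite -[leLHS]invrK lef_pV2 ?posrE ?invr_gt0//.
have NV2 : N%:R^-1 <= 2 * delta.
  rewrite -[delta]invrK ler_pdivlMr ?invr_gt0// ler_pdivrMl//.
  have : 1 <= N%:R :> R by rewrite ler1n.
  by move: dN; rewrite -addn1 natrD -/N; lra.
pose D w := \sum_(i < N) \sum_(j < N) cos ((i%:R - j%:R) * (Y w - x)).
have mcos l : measurable_fun setT (fun w => cos (l * (Y w - x))).
  apply: (@measurableT_comp _ _ _ _ _ _ (@cos R) _ (fun w => l * (Y w - x))).
    by apply: continuous_measurable_fun; exact: continuous_cos.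
  by apply: measurable_funM => //; apply: measurable_funB => //; exact: measurable_funPT.
have mD : measurable_fun setT D by do 2 apply: measurable_sum => ?.
have rowN (i : 'I_N) w : `|\sum_(j < N) cos ((i%:R - j%:R) * (Y w - x))| <= N%:R.
  apply: le_trans (ler_norm_sum _ _ _) _.
  rewrite -[leRHS]mulr1 -[N in leRHS]card_ord mulr_natl -sumr_const.
  by apply: ler_sum => j _; exact: cos_max.
(* This crude bound serves only integrability; the sharp one, linear in [N], holds for the
   expectation and comes next. *)
have DN w : `|D w| <= N%:R * N%:R.
  apply: le_trans (ler_norm_sum _ _ _) _.
  rewrite -[N in leRHS]card_ord mulr_natl -sumr_const.
  by apply: ler_sum => i _; rewrite card_ord rowN.
have ED : \int[P]_w D w <= N%:R * (2 * C).
  rewrite (@Rintegral_sum _ _ _ P _ _ _ (fun=> N%:R)); last first.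
  - by move=> i w; exact: rowN.
  - by move=> i; apply: measurable_sum => j.
  apply: le_trans; last first.
    apply: (@sum_distance_le R (fun m => expR (- m%:R `^ alpha))) sumC => m.
    exact: expR_ge0.
  apply: ler_sum => i _.
  rewrite (@Rintegral_sum _ _ _ P _ _ _ (fun=> 1)); last first.
  - by move=> j w; exact: cos_max.
  - by move=> j.
  apply: ler_sum => j _; apply: le_trans (stable_cos_le _ _ hY) _.
  suff -> : `|i%:R - j%:R| = ((i - j) + (j - i))%:R :> R.
    exact: lexx.
  have [ij|ij] := leqP j i.
    by rewrite -natrB// normr_nat (eqP (_ : (j - i)%N == 0%N)) ?addn0// subn_eq0.
  rewrite distrC -natrB ?(ltnW ij)// normr_nat.
  by rewrite (eqP (_ : (i - j)%N == 0%N)) ?add0n// subn_eq0 ltnW.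
(* With this normalization [c * D] is at least 1 where [Y] is within [1 / N] of [x]. *)
pose c : R := ((N%:R * cos 1) ^+ 2)^-1.
have c0 : 0 < c by rewrite invr_gt0 exprn_gt0// mulr_gt0.
have mY : measurable_fun setT Y by exact: measurable_funPT.
have ind1 z w : `|(Y w <= z)%R%:R| <= 1 :> R.
  by case: (leP (Y w) z) => _; rewrite ?normr0 ?normr1.
have mcD : measurable_fun setT (fun w => c * D w) by exact: measurable_funM.
have bcD w : `|c * D w| <= c * (N%:R * N%:R).
  by rewrite normrM (gtr0_norm c0) ler_pM2l.
have Icdf z := bounded_integrable P (measurable_indicator_le z mY) (ind1 z).
have IcD := bounded_integrable P mcD bcD.
(* Pointwise, the indicator of [Y <= x + delta] is at most that of [Y <= x] plus [c * D]. *)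
have le1 : fine (cdf Y (x + delta)) <= fine (cdf Y x) + c * \int[P]_w D w.
  rewrite !fine_cdf -RintegralZl//; last exact: bounded_integrable DN.
  rewrite -RintegralD//; apply: le_Rintegral => //.
    apply: (@bounded_integrable _ _ _ _ _ (1 + c * (N%:R * N%:R))).
      by apply: measurable_funD => //; exact: measurable_indicator_le.
    by move=> w; rewrite (le_trans (ler_normD _ _))// lerD.
  move=> w _; have D0 : 0 <= c * D w by rewrite mulr_ge0 ?fejer_ge0 ?ltW.
  case: (leP (Y w) x) => Yx.
    by rewrite (le_trans Yx) ?lerDl ?(ltW d0)//= lerDl.
  case: (leP (Y w) (x + delta)) => Yxd; last by rewrite add0r.
  rewrite add0r /c ler_pdivlMl ?exprn_gt0 ?mulr_gt0// mulr1.
  apply: fejer_ge => //; apply: le_trans dNV.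
  by rewrite ger0_norm; lra.
rewrite lerBlDl; apply: le_trans le1 _; rewrite lerD2l.
apply: (@le_trans _ _ (c * (N%:R * (2 * C)))); first by rewrite ler_pM2l.
have -> : c * (N%:R * (2 * C)) = 2 * C / cos 1 ^+ 2 * N%:R^-1.
  by rewrite /c; field; rewrite !gt_eqF.
have -> : 4 * C / cos 1 ^+ 2 * delta = 2 * C / cos 1 ^+ 2 * (2 * delta).
  by field; rewrite gt_eqF.
by rewrite ler_pM2l// divr_gt0 ?mulr_gt0 ?exprn_gt0.
Qed.

(** * Comparison of the Kolmogorov and smooth Wasserstein distances *)

Lemma Hclass_measurable (R : realType) (k : nat) (h : R -> R) : (0 < k)%N ->
  Hclass k h -> measurable_fun setT h.
Proof.
move=> k0 [dh _]; apply: continuous_measurable_fun => x.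
by apply: differentiable_continuous; apply/derivable1_diffP; exact: (dh 0%N).
Qed.

Lemma Hclass_expectation_bound (R : realType) (k : nat) (h : R -> R)
    d (T : measurableType d) (P : probability T R) (U : {RV P >-> R}) :
  (0 < k)%N -> Hclass k h -> `|fine 'E_P[h \o U]| <= 1.
Proof.
move=> k0 hk; rewrite fine_expectation; apply: Rintegral_prob_bound.
  apply: measurableT_comp; first exact: Hclass_measurable hk.
  exact: measurable_funPT.
by move=> w; exact: (hk.2 0%N).
Qed.

Section comparison.
Context (R : realType) d (T : measurableType d) (P : probability T R)
  (U : {RV P >-> R}) d' (T' : measurableType d') (Q : probability T' R)
  (V : {RV Q >-> R}) (k : nat)
  (k0 : (0 < k)%N).

Let W := smooth_wasserstein k U V.

Lemma le_smooth_wasserstein (h : R -> R) : Hclass k h ->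
  `|fine 'E_P[h \o U] - fine 'E_Q[h \o V]| <= W.
Proof.
move=> hk; apply: ub_le_sup; last by exists h.
(* [sup] is an upper bound only for a set bounded above; here 2 works because each expectation lies
   in [[-1, 1]]. *)
exists 2 => _ [g gk <-].
rewrite (le_trans (ler_normB _ _))// -[2]/(1 + 1).
by rewrite lerD// (Hclass_expectation_bound _ k0).
Qed.

Lemma smooth_wasserstein_ge0 : (k <= 3)%N -> 0 <= W.
Proof.
move=> k3; have d1 : 0 < (1 : R) <= 1 by apply/andP; split.
exact: le_trans (le_smooth_wasserstein (Hclass_smooth_cut 0 k3 d1)).
Qed.

Lemma smooth_wasserstein_le2 : (k <= 3)%N -> W <= 2.
Proof.
move=> k3; apply: ge_sup.
  eexists; exists (fun t => 1 ^+ k / 840 * smooth_cut 0 1 t); last by [].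
  by apply: Hclass_smooth_cut => //; apply/andP; split.
move=> _ [g gk <-].
rewrite (le_trans (ler_normB _ _))// -[2]/(1 + 1).
by rewrite lerD// (Hclass_expectation_bound _ k0).
Qed.

Lemma integrable_smooth_cut d0 (S : measurableType d0) (M : probability S R)
    (X : {RV M >-> R}) (a delta : R) : 0 < delta ->
  M.-integrable setT (EFin \o (fun w => smooth_cut a delta (X w))).
Proof.
move=> dgt0; apply: (@bounded_integrable _ _ _ _ _ 1).
  apply: (@measurableT_comp _ _ _ _ _ _ (smooth_cut a delta)); last exact: measurable_funPT.
  apply: continuous_measurable_fun => t.
  apply: differentiable_continuous; apply/derivable1_diffP.
  by have [] := is_derive_smooth_cut a delta t (isT : 0 < 3)%N.
move=> w; have := smoothstep_itv (clamp01_itv ((a - X w) / delta)).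
rewrite -/(smooth_cut a delta (X w)) ler_norml => /andP[p0 ->].
by rewrite andbT (le_trans _ p0)// oppr_le0.
Qed.

(** The cut enters the test class only after scaling by [delta ^+ k / 840]; undoing the scaling
    produces the factor on the right. *)
Lemma smooth_cut_wasserstein (a delta : R) : (k <= 3)%N -> 0 < delta <= 1 ->
  `|\int[P]_w smooth_cut a delta (U w) - \int[Q]_w smooth_cut a delta (V w)| <=
  840 * W / delta ^+ k.
Proof.
move=> k3 d01; have /andP[d0 _] := d01.
have hk := Hclass_smooth_cut a k3 d01.
have := le_smooth_wasserstein hk; rewrite !fine_expectation.
have c0 : 0 < delta ^+ k / 840 by apply: divr_gt0; [exact: exprn_gt0|rewrite ltr0n].
rewrite (RintegralZl _ measurableT (integrable_smooth_cut U a d0)).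
rewrite (RintegralZl _ measurableT (integrable_smooth_cut V a d0)).
rewrite -mulrBr normrM (gtr0_norm c0) -(ler_pdivlMl _ _ c0).
by rewrite invf_div mulrAC.
Qed.
(** The cut at [x + delta] bounds the cdf of [U] at [x] from above and the cut at [x] bounds it from
    below. Passing to [V] costs the Wasserstein term, and returning to the cdf of [V] at [x] costs
    one increment of length [delta]. *)
Lemma kolmogorov_le_cut (L delta : R) : (k <= 3)%N -> 0 < delta <= 1 ->
  (forall x, fine (cdf V (x + delta)) - fine (cdf V x) <= L * delta) ->
  kolmogorov U V <= L * delta + 840 * W / delta ^+ k.
Proof.
move=> k3 d01 lipV; have /andP[d0 _] := d01.
have sandwich d1 (T1 : measurableType d1) (P1 : probability T1 R)
    (U1 : {RV P1 >-> R}) a : fine (cdf U1 (a - delta)) <=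
    \int[P1]_w smooth_cut a delta (U1 w) <= fine (cdf U1 a).
  have mU : measurable_fun setT U1 by exact: measurable_funPT.
  have ind1 z w : `|(U1 w <= z)%R%:R| <= 1 :> R.
    by case: (leP (U1 w) z) => _; rewrite ?normr0 ?normr1.
  have Icdf z := bounded_integrable P1 (measurable_indicator_le z mU) (ind1 z).
  have Icut := integrable_smooth_cut U1 a d0.
  rewrite !fine_cdf; apply/andP; split; apply: le_Rintegral => // w _.
  - exact: smooth_cut_ge.
  - exact: smooth_cut_le.
apply: ge_sup; first by exists `|fine (cdf U 0) - fine (cdf V 0)|, 0.
move=> _ [x _ <-].
have := smooth_cut_wasserstein x k3 d01.
have := smooth_cut_wasserstein (x + delta) k3 d01.
have /andP[] := sandwich _ _ _ U x; have /andP[] := sandwich _ _ _ V x.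
have /andP[] := sandwich _ _ _ U (x + delta).
have /andP[] := sandwich _ _ _ V (x + delta).
(* The upper estimate uses the increment of [V] from [x], the lower one that from [x - delta]. *)
have := lipV x; have := lipV (x - delta); rewrite !addrK !subrK.
rewrite !ler_norml => ? ? ? ? ? ? ? ? ? ? /andP[? ?] /andP[? ?].
by apply/andP; split; lra.
Qed.

Lemma kolmogorov_le_wasserstein (L : R) : (k <= 3)%N -> 0 <= L ->
  (forall x delta, 0 < delta <= 1 ->
    fine (cdf V (x + delta)) - fine (cdf V x) <= L * delta) ->
  kolmogorov U V <= (L + 1680) * W `^ k.+1%:R^-1.
Proof.
move=> k3 L0 lipV.
have := smooth_wasserstein_ge0 k3; rewrite le_eqVlt => /predU1P[W0|W0].
  (* When [W = 0] the balancing scale would be 0, which is not admissible, so arbitrarily small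
     positive scales are used instead. Dividing by [L + 1] covers [L = 0]. *)
  rewrite -W0 powR0 ?invr_eq0 ?pnatr_eq0// mulr0.
  apply/ler_addgt0Pr => e e0; rewrite add0r.
  have e' : 0 < Num.min 1 (e / (L + 1)) <= 1.
    by rewrite lt_min ltr01 divr_gt0 ?ltr_wpDl//= ge_min lexx.
  apply: le_trans (kolmogorov_le_cut k3 e' (fun x => lipV x _ e')) _.
  rewrite -W0 mulr0 mul0r addr0.
  apply: (@le_trans _ _ ((L + 1) * (e / (L + 1)))).
    have /andP[/ltW m0 _] := e'.
    by apply: ler_pM => //; [rewrite lerDl|rewrite ge_min lexx orbT].
  by rewrite mulrC divfK// gt_eqF// ltr_wpDl.
have W2 := smooth_wasserstein_le2 k3.
(* Halving [W] ensures [delta <= 1], since [W <= 2]. Then [W / delta ^+ k = 2 * delta], whence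
   [1680 = 840 * 2]. *)
pose delta := (W / 2) `^ k.+1%:R^-1.
have h0 : 0 < W / 2 by rewrite divr_gt0.
have dk : delta ^+ k.+1 = W / 2.
  by rewrite -powR_mulrn ?powR_ge0// -powRrM mulVf ?pnatr_eq0// powRr1// ltW.
have d01 : 0 < delta <= 1.
  rewrite powR_gt0//= [leRHS](_ : 1 = 1 `^ k.+1%:R^-1); last by rewrite powR1.
  by apply: ge0_ler_powR; rewrite ?nnegrE ?invr_ge0 ?(ltW h0)// ler_pdivrMr// mul1r.
have /andP[d0 _] := d01.
apply: le_trans (kolmogorov_le_cut k3 d01 (fun x => lipV x _ d01)) _.
have -> : L * delta + 840 * W / delta ^+ k = (L + 1680) * delta.
  have -> : W = 2 * delta ^+ k * delta by rewrite -mulrA -exprSr dk mulrC divfK.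
  by field; rewrite expf_neq0// gt_eqF.
apply: ler_wpM2l; first by exact: addr_ge0 L0 (ler0n _ _).
apply: ge0_ler_powR; rewrite ?nnegrE ?invr_ge0 ?ltW//.
by rewrite ltr_pdivrMr// ltr_pMr// ltr1n.
Qed.

End comparison.

(** This removes the norm around the distance in the big-O statement. *)
Lemma kolmogorov_ge0 (R : realType) d (T : measurableType d)
    (P : probability T R) (U : {RV P >-> R}) d' (T' : measurableType d')
    (Q : probability T' R) (V : {RV Q >-> R}) : 0 <= kolmogorov U V.
Proof.
apply: le_trans (normr_ge0 (fine (cdf U 0) - fine (cdf V 0))) _.
apply: ub_le_sup; last by exists 0.
exists 2 => _ [x _ <-]; rewrite (le_trans (ler_normB _ _))// -[2]/(1 + 1).
have F1 d1 (T1 : measurableType d1) (P1 : probability T1 R)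
    (U1 : {RV P1 >-> R}) : `|fine (cdf U1 x)| <= 1.
  rewrite fine_cdf; apply: Rintegral_prob_bound.
    by apply: measurable_indicator_le; exact: measurable_funPT.
  by move=> w; case: (leP (U1 w) x) => _; rewrite ?normr0 ?normr1.
by rewrite lerD.
Qed.

Unset Implicit Arguments.

Theorem corollary1p6 (R : realType)
  (d : measure_display) (T : measurableType d) (P : probability T R)
  (d' : measure_display) (T' : measurableType d') (Q : probability T' R)
  (alpha beta A K gamma : R) (eps : R -> R)
  (X : nat -> {RV P >-> R}) (Y : {RV Q >-> R})
  (halpha : 0 < alpha < 2) (hbeta : -1 <= beta <= 1)
  (hbeta1 : alpha = 1 -> beta = 0)
  (hY : is_stable alpha beta Y)
  (hX : iid X)
  (hF : normal_attraction alpha A beta eps (fun x => fine (cdf (X 0%N) x)))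
  (hK : 0 < K) (hgamma : 0 <= gamma)
  (heps : forall x : R, x != 0 -> `|eps x| <= K / `|x| `^ gamma) :
  let S : nat -> {RV P >-> R} := fun n => normalized_sum X alpha A n in
  (1 <= alpha ->
    (fun n => kolmogorov (S n) Y) =O_\oo
    (fun n => smooth_wasserstein 3 (S n) Y `^ (4^-1))) /\
  (alpha < 1 ->
    (fun n => kolmogorov (S n) Y) =O_\oo
    (fun n => smooth_wasserstein 2 (S n) Y `^ (3^-1))).
Proof.
move=> S; have /andP[a0 _] := halpha.
have [L L0 lipY] := stable_cdf_increment a0 hY.
have bound k (k0 : (0 < k)%N) (k3 : (k <= 3)%N) :
    (fun n => kolmogorov (S n) Y) =O_\oo
    (fun n => smooth_wasserstein k (S n) Y `^ k.+1%:R^-1).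
  (* [L] depends only on the law of [Y], so the same constant serves every [n]. *)
  apply/eqO_exP; exists (L + 1680); first by apply: (addr_gt0 L0); rewrite ltr0n.
  near=> n; rewrite !ger0_norm ?powR_ge0 ?kolmogorov_ge0//.
  exact: kolmogorov_le_wasserstein k0 _ k3 (ltW L0) lipY.
by split=> _; exact: bound.
Unshelve. all: by end_near. Qed.
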